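(* There exist absolute constants $C>0$ and $M_0\in\mathbb N$ such that for all $M,N\in\mathbb N$ with $M\geq M_0$ and $N\geq e^{CM^7}$, \[\frac{D(N)}{N}\leq\frac{3}{4}\,\frac{D(M)}{M}.\]
   Context: For $N\in\mathbb N$, $D(N)$ denotes the maximum size of a subset $A\subseteq\{1,\dots,N\}$ that contains no two distinct elements whose difference is a perfect (non-zero) square, i.e. there are no $a,a'\in A$ and $n\in\mathbb N$, $n\geq 1$, with $a-a'=n^2$. *)

(* Defs.v *)
From mathcomp Require Import all_boot all_order all_algebra.
From mathcomp Require Import boolp.

Set Implicit Arguments.
Unset Strict Implicit.
Unset Printing Implicit Defensive.

Local Open Scope ring_scope.

(* The difference is taken in [int], so that it is not truncated. *)
Definition square_difference_free (N : nat) (A : {set 'I_N.+1}) : Prop :=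
  forall a a' : 'I_N.+1, a \in A -> a' \in A ->
  forall n : nat, (1 <= n)%N ->
  (a : nat)%:Z - (a' : nat)%:Z <> (n ^ 2)%N%:Z.

(* ['I_N.+1] is {0, ..., N}; excluding [ord0] leaves the subsets
   of {1, ..., N}. *)
Definition D (N : nat) : nat :=
  (\max_(A : {set 'I_N.+1} |
         (ord0 \notin A) && `[< square_difference_free A >]) #|A|)%N.

(* Main.v *)
(* Let A be a subset of {1..N} of size D(N) without square differences, with
   indicator f, and let g average f over the progressions x + w{1..M}, where w
   is a perfect square divisible by all small numbers.  Pulling A back along
   such a progression shows g <= delta := D(M)/M everywhere.  If A had density
   above 3/4 delta, expanding (delta - g(x)) (delta - g(x + s)) >= 0 would give
   sum_x g(x) g(x + s) >= c delta^2 N for every small s.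
   On the other hand sum_x g(x) g(x + s) = sum_x f(x) f~(x + s), with f~ an
   average of translates of f by multiples of w, while sum_x f(x) f(x + n^2) = 0.
   Average over s = (n + i)^2 with n < H, 1 <= i <= K, apply Cauchy-Schwarz and
   expand: for i < j, (n + j)^2 - (n + i)^2 is an arithmetic progression in n
   with step 2(j - i), which divides w, so f - f~ averages to almost 0 along it
   and only the diagonal terms survive; they are O(1/K).  This contradicts the
   lower bound once K >> M^2, H >> w M^3 and N >> H^2.
   Everything takes place in Z/LZ, with L so large that no relevant difference
   wraps around; sums are then exactly translation invariant. *)
Require Import Defs.
From mathcomp Require Import all_boot all_order all_algebra.
From mathcomp Require Import reals sequences exp.
From mathcomp Require Import boolp.
From mathcomp Require Import zify ring lra.

Set Implicit Arguments.
Unset Strict Implicit.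
Unset Printing Implicit Defensive.
Import Order.TTheory GRing.Theory Num.Theory.

Local Open Scope ring_scope.

(** * Cauchy-Schwarz and sums under translation *)

Lemma sum_mul_sqr_le (R : realFieldType) (I : finType) (a b : I -> R) :
  (\sum_i a i * b i) ^+ 2 <= (\sum_i a i ^+ 2) * (\sum_i b i ^+ 2).
Proof.
have H : 0 <= \sum_i \sum_j (a i * b j - a j * b i) ^+ 2.
  by apply: sumr_ge0 => i _; apply: sumr_ge0 => j _; apply: sqr_ge0.
(* Lagrange's identity: the double sum is twice the Cauchy-Schwarz defect. *)
have E : \sum_i \sum_j (a i * b j - a j * b i) ^+ 2 =
    2 * ((\sum_i a i ^+ 2) * (\sum_i b i ^+ 2) - (\sum_i a i * b i) ^+ 2).
  transitivity (\sum_i (a i ^+ 2 * (\sum_j b j ^+ 2)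
      + b i ^+ 2 * (\sum_j a j ^+ 2) - 2 * (a i * b i) * (\sum_j a j * b j))).
    apply: eq_bigr => i _; rewrite !mulr_sumr -big_split -sumrB /=.
    by apply: eq_bigr => j _; ring.
  by rewrite sumrB big_split /= -!mulr_suml -mulr_sumr; ring.
by move: H; rewrite E; lra.
Qed.

Lemma sum_addr (G : finZmodType) (R : zmodType) (F : G -> R) (c : G) :
  \sum_x F (x + c) = \sum_x F x.
Proof. by rewrite [RHS](reindex_inj (addIr c)). Qed.

(** Each unit shift of the window drops one value and gains another, both in [0, 1], so it costs at
    most 1. *)
Lemma dist_sum_shift (R : realFieldType) (v : nat -> R) (H m : nat) :
  (forall n, 0 <= v n <= 1) ->
  `|\sum_(n < H) v n - \sum_(n < H) v (n + m)%N| <= m%:R.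
Proof.
move=> v01; elim: m => [|m IHm].
  by under [X in _ - X]eq_bigr do rewrite addn0; rewrite subrr normr0.
have E : \sum_(n < H) v (n + m)%N - \sum_(n < H) v (n + m.+1)%N
    = v m - v (H + m)%N.
  elim: H {IHm} => [|H IH]; first by rewrite !big_ord0 add0n !subrr.
  rewrite !big_ord_recr /= addSnnS; move: IH; lra.
have := v01 m; have := v01 (H + m)%N; rewrite -natr1; move: IHm E.
by rewrite !ler_norml => /andP[? ?] ? /andP[? ?] /andP[? ?]; lra.
Qed.

(** Both sums are windows of the progression from [y - d * m], at offsets [m] and [m']; each is
    compared with the window at offset 0. *)
Lemma dist_sum_progression (G : finComNzRingType) (R : realFieldType)
    (f : G -> R) (d y : G) (H m m' : nat) :
  (forall x, 0 <= f x <= 1) ->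
  `|\sum_(n < H) f (y + d * n%:R)
    - \sum_(n < H) f (y - d * m%:R + d * m'%:R + d * n%:R)| <= (m + m')%:R.
Proof.
move=> f01.
have h (z : G) k : `|\sum_(n < H) f (z + d * n%:R)
    - \sum_(n < H) f (z + d * (n + k)%:R)| <= k%:R.
  exact: (@dist_sum_shift _ (fun n => f (z + d * n%:R))).
have := h (y - d * m%:R) m; have := h (y - d * m%:R) m'.
have -> : \sum_(n < H) f (y - d * m%:R + d * (n + m)%:R)
  = \sum_(n < H) f (y + d * n%:R).
  by apply: eq_bigr => n _; congr f; ring.
have -> : \sum_(n < H) f (y - d * m%:R + d * (n + m')%:R)
  = \sum_(n < H) f (y - d * m%:R + d * m'%:R + d * n%:R).
  by apply: eq_bigr => n _; congr f; ring.
by rewrite natrD !ler_norml => /andP[? ?] /andP[? ?]; apply/andP; split; lra.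
Qed.

(** * Averages over a family of translates *)

Definition ap_avg (G : finComNzRingType) (R : realFieldType) (I : finType)
    (t : I -> G) (f : G -> R) (x : G) : R :=
  #|I|%:R^-1 * \sum_i f (x + t i).

(** This is f~: the operator [ap_avg] followed by its adjoint, which averages over the translates by
    [- t i]. *)
Definition ap_smooth (G : finComNzRingType) (R : realFieldType) (I : finType)
    (t : I -> G) (f : G -> R) (x : G) : R :=
  #|I|%:R^-1 ^+ 2 * \sum_i \sum_j f (x - t i + t j).

Lemma sum_ap_avg (G : finComNzRingType) (R : realFieldType) (I : finType)
    (t : I -> G) (f : G -> R) :
  (0 < #|I|)%N -> \sum_x ap_avg t f x = \sum_x f x.
Proof.
move=> I0; rewrite -mulr_sumr exchange_big /=.
under eq_bigr do rewrite sum_addr.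
by rewrite sumr_const -[X in _ * X]mulr_natl mulKf // pnatr_eq0 -lt0n.
Qed.

Lemma sum_ap_smooth (G : finComNzRingType) (R : realFieldType) (I : finType)
    (t : I -> G) (f : G -> R) :
  (0 < #|I|)%N -> \sum_x ap_smooth t f x = \sum_x f x.
Proof.
move=> I0; rewrite -mulr_sumr exchange_big /=.
under eq_bigr do rewrite exchange_big /=.
have shift i j : \sum_x f (x - t i + t j) = \sum_x f x.
  by rewrite (sum_addr (fun x => f (x + t j))) sum_addr.
under eq_bigr do under eq_bigr do rewrite shift.
rewrite !sumr_const -mulrnA -[X in _ * X]mulr_natl natrM expr2 mulrA.
rewrite -invfM mulVf ?mul1r // mulf_neq0 //.
all: by rewrite pnatr_eq0 -lt0n.
Qed.

Lemma ap_smooth01 (G : finComNzRingType) (R : realFieldType) (I : finType)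
    (t : I -> G) (f : G -> R) (x : G) :
  (0 < #|I|)%N -> (forall x, 0 <= f x <= 1) -> 0 <= ap_smooth t f x <= 1.
Proof.
move=> I0 f01; apply/andP; split.
  rewrite mulr_ge0 ?exprn_ge0 ?invr_ge0 //.
  by apply: sumr_ge0 => i _; apply: sumr_ge0 => j _; case/andP: (f01 (x - t i + t j)).
rewrite /ap_smooth exprVn ler_pdivrMl ?exprn_gt0 ?ltr0n // mulr1.
apply: (@le_trans _ _ (\sum_(i : I) \sum_(j : I) 1)).
  by apply: ler_sum => i _; apply: ler_sum => j _; case/andP: (f01 (x - t i + t j)).
by rewrite !sumr_const -mulrnA mulnn natrX.
Qed.

(** Replacing [x] by [x - t i] in each expanded term moves all averaging onto the second factor and
    leaves a bare [f] in the first. *)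
Lemma sum_ap_avg_shift (G : finComNzRingType) (R : realFieldType) (I : finType)
    (t : I -> G) (f : G -> R) (s : G) :
  \sum_x ap_avg t f x * ap_avg t f (x + s)
    = \sum_x f x * ap_smooth t f (x + s).
Proof.
transitivity (#|I|%:R^-1 ^+ 2 *
    \sum_i \sum_j \sum_x f (x + t i) * f (x + s + t j)).
  under eq_bigr do rewrite mulrACA big_distrlr /=.
  rewrite -mulr_sumr exchange_big /=; congr (_ * _).
  by apply: eq_bigr => i _; rewrite exchange_big.
under [RHS]eq_bigr do rewrite mulrCA mulr_sumr.
rewrite -mulr_sumr [in RHS]exchange_big /=; congr (_ * _).
apply: eq_bigr => i _; under [RHS]eq_bigr do rewrite mulr_sumr.
rewrite [RHS]exchange_big /=; apply: eq_bigr => j _.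
rewrite -(sum_addr _ (- t i)).
by apply: eq_bigr => x _; rewrite addrNK; congr (_ * f _); ring.
Qed.

Lemma le_sum_ap_smooth (G : finComNzRingType) (R : realFieldType)
    (I : finType) (t : I -> G) (f : G -> R) (delta : R) (s : G) :
  (0 < #|I|)%N -> (forall x, ap_avg t f x <= delta) ->
  delta * (2 * \sum_x f x - delta * #|G|%:R)
    <= \sum_x f x * ap_smooth t f (x + s).
Proof.
move=> I0 le_delta; rewrite -sum_ap_avg_shift.
have : 0 <= \sum_x (delta - ap_avg t f x) * (delta - ap_avg t f (x + s)).
  by apply: sumr_ge0 => x _; rewrite mulr_ge0 ?subr_ge0.
have -> : \sum_x (delta - ap_avg t f x) * (delta - ap_avg t f (x + s)) =
    \sum_(x : G) delta ^+ 2
    - delta * \sum_x ap_avg t f x - delta * \sum_x ap_avg t f (x + s)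
    + \sum_x ap_avg t f x * ap_avg t f (x + s).
  rewrite !mulr_sumr -!sumrB -big_split; apply: eq_bigr => x _ /=; ring.
rewrite (sum_addr (ap_avg t f)) sum_ap_avg // sumr_const -mulr_natl.
by lra.
Qed.

(** * The residual f - f~ and its correlation with [f] along squares *)

Definition residual (G : finComNzRingType) (R : realFieldType) (I : finType)
    (t : I -> G) (f : G -> R) (x : G) : R := f x - ap_smooth t f x.

Lemma normr_residual_le1 (G : finComNzRingType) (R : realFieldType)
    (I : finType) (t : I -> G) (f : G -> R) (x : G) :
  (0 < #|I|)%N -> (forall x, 0 <= f x <= 1) -> `|residual t f x| <= 1.
Proof.
move=> I0 f01; move: (f01 x) (ap_smooth01 t x I0 f01).
by rewrite ler_norml /residual; lra.
Qed.

Lemma sum_normr_residual (G : finComNzRingType) (R : realFieldType)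
    (I : finType) (t : I -> G) (f : G -> R) :
  (0 < #|I|)%N -> (forall x, 0 <= f x <= 1) ->
  \sum_x `|residual t f x| <= 2 * \sum_x f x.
Proof.
move=> I0 f01; rewrite mulr_natl mulr2n -[X in _ + X](sum_ap_smooth t f I0).
rewrite -big_split /=; apply: ler_sum => x _.
move: (f01 x) (ap_smooth01 t x I0 f01).
by rewrite ler_norml /residual; lra.
Qed.

(** Each translate in f~ slides the progression back [k i] and forward [k j] steps, so only boundary
    terms, at most [k i + k j], survive. *)
Lemma sum_residual_progression (G : finComNzRingType) (R : realFieldType)
    (I : finType) (t : I -> G) (k : I -> nat) (B : nat) (f : G -> R)
    (d y : G) (H : nat) :
  (0 < #|I|)%N -> (forall x, 0 <= f x <= 1) ->
  (forall i, t i = d * (k i)%:R) -> (forall i, (k i <= B)%N) ->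
  `|\sum_(n < H) residual t f (y + d * n%:R)| <= (2 * B)%:R.
Proof.
move=> I0 f01 tE kB.
have nz : #|I|%:R != 0 :> R by rewrite pnatr_eq0 -lt0n.
have -> : \sum_(n < H) residual t f (y + d * n%:R) =
    #|I|%:R^-1 ^+ 2 * \sum_i \sum_j (\sum_(n < H) f (y + d * n%:R)
      - \sum_(n < H) f (y - d * (k i)%:R + d * (k j)%:R + d * n%:R)).
  rewrite sumrB; under [X in _ = _ * X]eq_bigr do rewrite sumrB.
  rewrite sumrB mulrBr; congr (_ - _).
    rewrite !sumr_const -mulrnA -[X in _ = _ * X]mulr_natl natrM expr2 mulrA.
    by rewrite -invfM mulVf ?mul1r // mulf_neq0.
  rewrite -mulr_sumr exchange_big /=; congr (_ * _); apply: eq_bigr => i _.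
  rewrite exchange_big /=; apply: eq_bigr => j _; apply: eq_bigr => n _.
  by congr f; rewrite !tE; ring.
rewrite normrM ger0_norm ?exprn_ge0 ?invr_ge0 //.
rewrite exprVn ler_pdivrMl ?exprn_gt0 ?ltr0n //.
apply: (@le_trans _ _ (\sum_(i : I) \sum_(j : I) (2 * B)%:R)).
  apply: le_trans (ler_norm_sum _ _ _) _; apply: ler_sum => i _.
  apply: le_trans (ler_norm_sum _ _ _) _; apply: ler_sum => j _.
  apply: le_trans (dist_sum_progression _ _ _ _ _ f01) _.
  by rewrite ler_nat mul2n -addnn leq_add.
by rewrite !sumr_const -mulrnA -[leLHS]mulr_natl natrM expr2.
Qed.

Lemma sum_residual_squares (G : finComNzRingType) (R : realFieldType)
    (I : finType) (t : I -> G) (B H K : nat) (f : G -> R) :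
  (0 < #|I|)%N -> (forall x, 0 <= f x <= 1) ->
  (forall h, (0 < h < K)%N ->
     exists2 k : I -> nat, forall i, t i = (2 * h)%:R * (k i)%:R
                         & forall i, (k i <= B)%N) ->
  (\sum_x f x * \sum_(n < H) \sum_(i < K)
      residual t f (x + ((n + i.+1) ^ 2)%:R)) ^+ 2
    <= (\sum_x f x) ^+ 2 * (H%:R * (2 * H * K + 4 * K ^ 2 * B)%:R).
Proof.
move=> I0 f01 tP; set u := residual t f; set a := \sum_x f x.
have a0 : 0 <= a by apply: sumr_ge0 => x _; case/andP: (f01 x).
have u1 x : `|u x| <= 1 by apply: normr_residual_le1.
have su : \sum_x `|u x| <= 2 * a by apply: sum_normr_residual.
have off (i j : nat) : (i < j < K)%N ->
    \sum_(n < H) \sum_x u (x + ((n + i.+1) ^ 2)%:R) * u (x + ((n + j.+1) ^ 2)%:R)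
      <= 4 * a * B%:R.
  move=> /andP[ij jK].
  have [k tE kB] : exists2 k : I -> nat,
      forall l, t l = (2 * (j - i))%:R * (k l)%:R & forall l, (k l <= B)%N.
    by apply: tP; lia.
  (* Put y = x + (n + i + 1)^2. The remaining shift (n + j + 1)^2 - (n + i + 1)^2 is linear in [n],
     with step 2(j - i). *)
  have -> : \sum_(n < H) \sum_x u (x + ((n + i.+1) ^ 2)%:R) * u (x + ((n + j.+1) ^ 2)%:R)
    = \sum_y u y * \sum_(n < H)
        u (y + ((j - i) * (i + j + 2))%:R + (2 * (j - i))%:R * n%:R).
    under [RHS]eq_bigr do rewrite mulr_sumr.
    rewrite [RHS]exchange_big /=; apply: eq_bigr => n _.
    rewrite -[RHS](sum_addr _ ((n + i.+1) ^ 2)%:R); apply: eq_bigr => x _.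
    congr (_ * u _); rewrite -natrM -!addrA -!natrD; congr (_ + _%:R).
    by nia.
  apply: (@le_trans _ _ (\sum_y `|u y| * (2 * B)%:R)).
    apply: ler_sum => y _; apply: le_trans (ler_norm _) _; rewrite normrM.
    by rewrite ler_wpM2l // (sum_residual_progression _ _ I0 f01 tE kB).
  by rewrite -mulr_suml natrM; move: su (ler0n R B); nra.
(* The diagonal uses only |u| <= 1; its spare [B] term lets one formula cover all pairs. The case j
   < i follows by commutativity. *)
have pair (i j : 'I_K) :
    \sum_(n < H) \sum_x u (x + ((n + i.+1) ^ 2)%:R) * u (x + ((n + j.+1) ^ 2)%:R)
      <= (i == j)%:R * (2 * a * H%:R) + 4 * a * B%:R.
  have B0 : 0 <= 4 * a * B%:R by rewrite !mulr_ge0.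
  have [->|ne] := eqVneq i j.
    apply: (@le_trans _ _ (\sum_(n < H) 2 * a)); last first.
      by rewrite sumr_const card_ord -[leLHS]mulr_natl mul1r; move: B0; lra.
    apply: ler_sum => n _; rewrite (sum_addr (fun x => u x * u x)).
    apply: le_trans su; apply: ler_sum => x _.
    by apply: le_trans (ler_norm _) _; rewrite normrM ler_piMr.
  rewrite mul0r add0r; have [lt|] := ltnP i j; first by rewrite off ?lt /=.
  rewrite leq_eqVlt => /orP[/eqP/esym/val_inj eij|lt].
    by rewrite eij eqxx in ne.
  under eq_bigr do under eq_bigr do rewrite mulrC.
  by rewrite off ?lt /=.
(* Cauchy-Schwarz in [x]; below it is applied again in [n], against the constant 1, which costs the
   factor [H]. *)
apply: le_trans (sum_mul_sqr_le _ _) _; rewrite [a ^+ 2]expr2 -mulrA.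
have f2 : \sum_x f x ^+ 2 <= a.
  apply: ler_sum => x _; move: (f01 x) => /andP[? ?].
  by rewrite expr2 ler_piMr.
apply: ler_pM => //; do ?by apply: sumr_ge0 => x _; apply: sqr_ge0.
apply: (@le_trans _ _ (\sum_x H%:R * \sum_(n < H)
    (\sum_(i < K) u (x + ((n + i.+1) ^ 2)%:R)) ^+ 2)).
  apply: ler_sum => x _.
  have := sum_mul_sqr_le (fun _ : 'I_H => 1)
    (fun n : 'I_H => \sum_(i < K) u (x + ((n + i.+1) ^ 2)%:R)).
  under eq_bigr do rewrite mul1r.
  by under [X in _ <= X * _ -> _]eq_bigr do rewrite expr1n; rewrite sumr_const card_ord.
rewrite -mulr_sumr mulrCA ler_wpM2l //.
have -> : \sum_x \sum_(n < H) (\sum_(i < K) u (x + ((n + i.+1) ^ 2)%:R)) ^+ 2 =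
  \sum_(i < K) \sum_(j < K) \sum_(n < H) \sum_x
    u (x + ((n + i.+1) ^ 2)%:R) * u (x + ((n + j.+1) ^ 2)%:R).
  rewrite exchange_big /=.
  under eq_bigr do under eq_bigr do rewrite expr2 big_distrlr /=.
  under eq_bigr do rewrite exchange_big /=.
  rewrite exchange_big /=; apply: eq_bigr => i _.
  under eq_bigr do rewrite exchange_big /=.
  by rewrite exchange_big.
apply: (@le_trans _ _ (\sum_(i < K) \sum_(j < K)
    ((i == j)%:R * (2 * a * H%:R) + 4 * a * B%:R))).
  by do 2![apply: ler_sum => ? _]; apply: pair.
under eq_bigr => i _.
  rewrite big_split /= -mulr_suml (bigD1 i) //= eqxx big1; last first.
    by move=> j /negbTE; rewrite eq_sym => ->.
  rewrite addr0 mul1r sumr_const card_ord; over.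
by rewrite sumr_const card_ord le_eqVlt; apply: predU1l; ring.
Qed.

(** As [f] does not correlate with its translates by squares, its correlation with the residual is
    minus that with f~. The latter is at least [b] for each of the [H * K] shifts, so the sum can be
    squared and compared with [sum_residual_squares]. *)
Lemma square_correlation_bound (G : finComNzRingType) (R : realFieldType)
    (I : finType) (t : I -> G) (B H K : nat) (f : G -> R) (delta : R) :
  (0 < #|I|)%N -> (0 < H)%N -> (0 < K)%N -> (forall x, 0 <= f x <= 1) ->
  (forall h, (0 < h < K)%N ->
     exists2 k : I -> nat, forall i, t i = (2 * h)%:R * (k i)%:R
                         & forall i, (k i <= B)%N) ->
  (forall x, ap_avg t f x <= delta) ->
  (forall n, (0 < n <= H + K)%N -> \sum_x f x * f (x + (n ^ 2)%:R) = 0) ->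
  0 <= delta * (2 * \sum_x f x - delta * #|G|%:R) ->
  (delta * (2 * \sum_x f x - delta * #|G|%:R)) ^+ 2 * (H * K)%:R
    <= (\sum_x f x) ^+ 2 * (2 * H + 4 * K * B)%:R.
Proof.
move=> I0 H0 K0 f01 tP le_delta nosq; set b := delta * _ => b0.
have := sum_residual_squares H I0 f01 tP.
set P := \sum_x _ * _.
have leP : (H * K)%:R * b <= - P.
  have -> : - P = \sum_(n < H) \sum_(i < K)
      \sum_x f x * ap_smooth t f (x + ((n + i.+1) ^ 2)%:R).
    transitivity (- \sum_(n < H) \sum_(i < K)
        \sum_x f x * residual t f (x + ((n + i.+1) ^ 2)%:R)).
      congr (- _); rewrite /P; under eq_bigr do rewrite mulr_sumr.
      rewrite exchange_big /=; apply: eq_bigr => n _.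
      by under eq_bigr do rewrite mulr_sumr; rewrite exchange_big.
    rewrite -sumrN; apply: eq_bigr => n _; rewrite -sumrN.
    apply: eq_bigr => i _; under eq_bigr do rewrite mulrBr.
    rewrite sumrB nosq ?sub0r ?opprK //.
    by have := ltn_ord n; have := ltn_ord i; lia.
  have -> : (H * K)%:R * b = \sum_(n < H) \sum_(i < K) b.
    by rewrite !sumr_const !card_ord -mulrnA mulr_natl mulnC.
  by do 2![apply: ler_sum => ? _]; apply: le_sum_ap_smooth.
have HK0 : 0 < (H * K)%:R :> R by rewrite ltr0n muln_gt0 H0.
have Hb0 : 0 <= (H * K)%:R * b by rewrite mulr_ge0.
have : ((H * K)%:R * b) ^+ 2 <= P ^+ 2.
  by rewrite -[P ^+ 2]sqrrN lerXn2r // nnegrE // (le_trans Hb0).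
move=> /le_trans h /h {}h; rewrite -(ler_pM2l HK0).
set a := \sum_x f x in h *; set c := (2 * H + 4 * K * B)%:R.
have cE : (2 * H * K + 4 * K ^ 2 * B)%:R = K%:R * c :> R.
  by rewrite -natrM; congr _%:R; nia.
rewrite natrM cE in h *.
have -> : H%:R * K%:R * (b ^+ 2 * (H%:R * K%:R)) = (H%:R * K%:R * b) ^+ 2.
  by ring.
by have -> : H%:R * K%:R * (a ^+ 2 * c) = a ^+ 2 * (H%:R * (K%:R * c)) by ring.
Qed.

(** * Extremal sets and their transfer to Z/LZ *)

Lemma card_le_D (N : nat) (A : {set 'I_N.+1}) :
  ord0 \notin A -> square_difference_free A -> (#|A| <= D N)%N.
Proof.
by move=> A0 Asdf; apply: leq_bigmax_cond; rewrite A0; apply/asboolP.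
Qed.

Lemma D_attained (N : nat) :
  exists A : {set 'I_N.+1},
    [/\ ord0 \notin A, square_difference_free A & #|A| = D N].
Proof.
rewrite /D (bigop.bigmax_eq_arg set0); last first.
  by rewrite in_set0; apply/asboolP => a a'; rewrite in_set0.
case: arg_maxnP => [|A /andP[A0 /asboolP Asdf] _]; last by exists A.
by rewrite in_set0; apply/asboolP => a a'; rewrite in_set0.
Qed.

Lemma D_gt0 (N : nat) : (0 < N)%N -> (0 < D N)%N.
Proof.
move=> N0; rewrite -(cards1 (ord_max : 'I_N.+1)); apply: card_le_D.
  by rewrite inE -val_eqE /= neq_ltn N0.
move=> a a' /set1P-> /set1P-> n n1; rewrite subrr => /eqP.
by rewrite eq_sym eqz_nat expn_eq0; lia.
Qed.

Lemma natr_Zp_inj (L m n : nat) :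
  (1 < L)%N -> (m < L)%N -> (n < L)%N -> m%:R = n%:R :> 'Z_L -> m = n.
Proof.
by move=> L1 mL nL /(congr1 val); rewrite /= !val_Zp_nat // !modn_small.
Qed.

Lemma D_correlation_bound (R : realFieldType) (M N H K r : nat) :
  let w := (r ^ 2)%N in
  let L := (N + w * M + (H + K) ^ 2)%N in
  let delta := (D M)%:R / M%:R : R in
  let b := delta * (2 * (D N)%:R - delta * L%:R) in
  (0 < M)%N -> (0 < H)%N -> (0 < K)%N -> (0 < r)%N ->
  (forall h, (0 < h < K)%N -> (2 * h %| r)%N) ->
  (D N)%:R <= delta * L%:R /\
  (0 <= b ->
     b ^+ 2 * (H * K)%:R <= (D N)%:R ^+ 2 * (2 * H + 4 * K * (w * M))%:R).
Proof.
move=> w L delta b M0 H0 K0 r0 dvd_r.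
have [A [A0 Asdf cardA]] := D_attained N.
have L1 : (1 < L)%N by rewrite /L; nia.
pose toZ (a : 'I_N.+1) : 'Z_L := (a : nat)%:R.
pose S := [set toZ a | a in A].
pose f (x : 'Z_L) : R := (x \in S)%:R.
pose t (l : 'I_M) : 'Z_L := (w * l.+1)%:R.
have M0' : (0 < #|'I_M|)%N by rewrite card_ord.
have f01 x : 0 <= f x <= 1 by rewrite /f; case: (x \in S); rewrite ?lexx ?ler01.
have sum_mem (T : finType) (P : {set T}) : \sum_x (x \in P)%:R = #|P|%:R :> R.
  rewrite -natr_sum -sum1_card [in RHS]big_mkcond /=.
  by congr _%:R; apply: eq_bigr => x _; case: ifP.
have sumf : \sum_x f x = (D N)%:R.
  rewrite sum_mem card_in_imset ?cardA // => a a' _ _ /natr_Zp_inj eqa.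
  apply/val_inj/eqa => //; rewrite /L.
    by have := ltn_ord a; nia.
  by have := ltn_ord a'; nia.
have cardZ : #|'Z_L|%:R = L%:R :> R by rewrite card_ord Zp_cast.
have memS (x : 'Z_L) : x \in S -> exists2 a : 'I_N.+1, a \in A & x = (a : nat)%:R.
  by case/imsetP => a; exists a.
(* The l in {1..M} with x + w l in [S] form a set without square differences: l - l' = n^2 would
   give the difference w n^2 = (r n)^2 in [A]. [lift ord0] sends an index [l] to [l.+1]. *)
have le_delta x : ap_avg t f x <= delta.
  rewrite /ap_avg card_ord /delta mulrC ler_pM2r ?invr_gt0 ?ltr0n //.
  have -> : \sum_(l < M) f (x + t l) = #|[set l | x + t l \in S]|%:R.
    by rewrite -sum_mem; apply: eq_bigr => l _; rewrite inE.
  rewrite ler_nat -(card_imset _ (@lift_inj _ ord0)); apply: card_le_D.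
    by apply/imsetP => -[l _ /eqP]; rewrite -val_eqE.
  move=> _ _ /imsetP[l + ->] /imsetP[l' + ->] n n1.
  rewrite !inE !lift0 => /memS[a aA xa] /memS[a' aA' xa'] eqn.
  apply: (Asdf a a' aA aA' (r * n)%N); first by rewrite muln_gt0 r0.
  have : ((a : nat) + w * l'.+1)%N = (a' + w * l.+1)%N.
    apply: (@natr_Zp_inj L) => //; rewrite /L.
    - by have := ltn_ord a; have := ltn_ord l'; nia.
    - by have := ltn_ord a'; have := ltn_ord l; nia.
    by rewrite !natrD -xa -xa' /t; ring.
  move/eqP: eqn; rewrite subr_eq -PoszD eqz_nat => /eqP ->.
  rewrite mulnDr addnA => /addIn ->.
  by rewrite expnMn PoszD addrC addKr.
have nosq n : (0 < n <= H + K)%N -> \sum_x f x * f (x + (n ^ 2)%:R) = 0.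
  move=> /andP[n0 nle]; apply: big1 => x _; rewrite /f.
  case: (boolP (x \in S)) => [/memS[a aA xa]|_]; last by rewrite mul0r.
  case: (boolP (_ \in S)) => [/memS[a' aA' xa']|_]; last by rewrite mulr0.
  case: (Asdf a' a aA' aA n n0).
  have : ((a : nat) + n ^ 2)%N = a'.
    (* Both sides are at most N + (H + K)^2 < L, so the congruence is an equality of integers. *)
    apply: (@natr_Zp_inj L) => //; rewrite /L.
    - by have := ltn_ord a; nia.
    - by have := ltn_ord a'; nia.
    by rewrite natrD -xa xa'.
  by lia.
split.
  rewrite -sumf -(sum_ap_avg t f M0') -cardZ mulr_natr -sumr_const.
  exact: ler_sum.
rewrite /b -sumf -cardZ.
apply: (square_correlation_bound M0' H0 K0 f01 _ le_delta nosq) => h hK.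
have dvdw : (2 * h %| w)%N by rewrite /w (dvdn_trans (dvd_r h hK)) // dvdn_exp.
exists (fun l : 'I_M => (w %/ (2 * h) * l.+1)%N) => l.
  by rewrite -natrM mulnA [(2 * h * _)%N]mulnC divnK.
by rewrite leq_mul ?leq_div // ltn_ord.
Qed.

(** * The density decrement for explicit parameters *)

Lemma D_density_decrement (R : realFieldType) (M N H K r : nat) :
  (0 < M)%N -> (0 < r)%N ->
  K = (512 * M ^ 2)%N -> H = (1024 * M ^ 3 * r ^ 2)%N ->
  (forall h, (0 < h < K)%N -> (2 * h %| r)%N) ->
  (4 * (r ^ 2 * M + (H + K) ^ 2) <= N)%N ->
  (D N)%:R / N%:R <= 3 / 4 * ((D M)%:R / M%:R) :> R.
Proof.
move=> M0 r0 KE HE dvd_r leN.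
have K0 : (0 < K)%N by rewrite KE; nia.
have H0 : (0 < H)%N by rewrite HE !muln_gt0 ?expn_gt0 M0 r0.
have N0 : (0 < N)%N by nia.
have [] := @D_correlation_bound R M N H K r M0 H0 K0 r0 dvd_r.
set w := (r ^ 2)%N in HE leN *; set L := (_ + _)%N.
set a := (D N)%:R; set delta := _ / M%:R.
have m0 : 0 < M%:R :> R by rewrite ltr0n.
have n0 : 0 < N%:R :> R by rewrite ltr0n.
have delta_ge : 1 <= delta * M%:R by rewrite divfK ?gt_eqF // ler1n D_gt0.
have delta0 : 0 < delta by rewrite divr_gt0 // ltr0n D_gt0.
have leL : 4 * L%:R <= 5 * N%:R :> R by rewrite -!natrM ler_nat /L; lia.
move=> ale bound; rewrite ler_pdivrMr // leNgt; apply/negP => age.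
(* If a > 3/4 delta N, then L <= 5/4 N gives 2a - delta L > (3/2 - 5/4) delta N. *)
have b_ge : delta ^+ 2 * N%:R / 4 <= delta * (2 * a - delta * L%:R).
  have -> : delta ^+ 2 * N%:R / 4 = delta * (delta * N%:R / 4) by field.
  rewrite ler_pM2l //.
  have : delta * (4 * L%:R) <= delta * (5 * N%:R) by rewrite ler_pM2l.
  by move: age; lra.
have q0 : 0 < delta ^+ 2 * N%:R / 4 by rewrite divr_gt0 // mulr_gt0 // exprn_gt0.
have := bound (le_trans (ltW q0) b_ge).
have a_le : a <= 2 * (delta * N%:R).
  have : delta * (4 * L%:R) <= delta * (5 * N%:R) by rewrite ler_pM2l.
  have : 0 < delta * N%:R by rewrite mulr_gt0.
  by move: ale; lra.
set c := (2 * H + _)%N => le1.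
have b2 : (delta ^+ 2 * N%:R / 4) ^+ 2 <= (delta * (2 * a - delta * L%:R)) ^+ 2.
  by rewrite lerXn2r // nnegrE ltW // (lt_le_trans q0).
have a2 : a ^+ 2 <= (2 * (delta * N%:R)) ^+ 2.
  by rewrite lerXn2r // nnegrE ?ler0n // mulr_ge0 // mulr_ge0 // ltW.
have le2 : (delta ^+ 2 * N%:R / 4) ^+ 2 * (H * K)%:R
    <= (2 * (delta * N%:R)) ^+ 2 * c%:R.
  apply: le_trans (ler_wpM2r (ler0n _ _) b2) _.
  by apply: le_trans le1 (ler_wpM2r (ler0n _ _) a2).
have le3 : delta ^+ 2 * (H * K)%:R <= 64 * c%:R.
  have p0 : 0 < (delta * N%:R) ^+ 2 by rewrite exprn_gt0 // mulr_gt0.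
  rewrite -(ler_pM2l p0) -subr_ge0.
  have -> : (delta * N%:R) ^+ 2 * (64 * c%:R)
      - (delta * N%:R) ^+ 2 * (delta ^+ 2 * (H * K)%:R) =
    16 * ((2 * (delta * N%:R)) ^+ 2 * c%:R
      - (delta ^+ 2 * N%:R / 4) ^+ 2 * (H * K)%:R) by field.
  by rewrite mulr_ge0 // subr_ge0.
(* A singleton shows D(M) >= 1, so delta >= 1/M and [delta] can be eliminated. *)
have le4 : (H * K)%:R <= (64 * M ^ 2 * c)%:R :> R.
  have d2 : 1 <= (delta * M%:R) ^+ 2 by rewrite exprn_ege1.
  apply: le_trans (_ : (delta * M%:R) ^+ 2 * (H * K)%:R <= _).
    by rewrite ler_peMl.
  have -> : (64 * M ^ 2 * c)%:R = M%:R ^+ 2 * (64 * c%:R) :> R.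
    by ring.
  rewrite exprMn mulrAC mulrC.
  by rewrite ler_wpM2l // exprn_ge0.
move: le4; rewrite ler_nat leqNgt => /negP; apply.
have HK0 : (0 < H * K)%N by rewrite muln_gt0 H0.
rewrite /c.
have -> : (64 * M ^ 2 * (2 * H + 4 * K * (w * M)) =
  128 * M ^ 2 * H + 256 * M ^ 3 * w * K)%N by ring.
(* [K] and [H] make each of the two terms a quarter of [H * K], so their sum falls short of it. *)
have e1 : (4 * (128 * M ^ 2 * H) = H * K)%N by rewrite KE; ring.
have e2 : (4 * (256 * M ^ 3 * w * K) = H * K)%N by rewrite HE; ring.
move: (128 * _ * H)%N (256 * _ * w * K)%N (H * K)%N e1 e2 HK0; clear.
by lia.
Qed.

(** * Size of the threshold for [N] *)

Lemma fact_le_expR (R : realType) (n : nat) : (n`!)%:R <= expR (n%:R ^+ 2) :> R.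
Proof.
elim: n => [|n IHn]; first by rewrite fact0 expr0n expR0.
rewrite factS natrM.
apply: (@le_trans _ _ (expR n.+1%:R * expR (n%:R ^+ 2))).
  by apply: ler_pM => //; apply: le_trans (expR_ge1Dx _); lra.
rewrite -expRD ler_expR -natr1; have := ler0n R n; nra.
Qed.

Lemma threshold_le_expR (R : realType) (M H K r : nat) :
  (0 < M)%N -> K = (512 * M ^ 2)%N -> r = (2 * K`!)%N ->
  H = (1024 * M ^ 3 * r ^ 2)%N ->
  (4 * (r ^ 2 * M + (H + K) ^ 2))%:R
    <= expR ((321 * 1024 ^+ 2 + 1) * M%:R ^+ 7) :> R.
Proof.
move=> M0 KE rE HE.
have r0 : (0 < r)%N by rewrite rE muln_gt0 fact_gt0.
have leH : (4 * (r ^ 2 * M + (H + K) ^ 2) <= 20 * H ^ 2)%N.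
  have h1 : (r ^ 2 * M <= H)%N by rewrite HE; nia.
  have h2 : (K <= H)%N by rewrite HE KE; nia.
  have h3 : (H <= H ^ 2)%N by nia.
  have h4 : ((H + K) ^ 2 <= 4 * H ^ 2)%N by nia.
  by lia.
have m1 : 1 <= M%:R :> R by rewrite ler1n.
have m47 : M%:R ^+ 4 <= M%:R ^+ 7 :> R by rewrite ler_weXn2l.
have m67 : M%:R ^+ 6 <= M%:R ^+ 7 :> R by rewrite ler_weXn2l.
have m7 : 1 <= M%:R ^+ 7 :> R by rewrite exprn_ege1.
apply: le_trans (_ : (20 * H ^ 2)%:R <= _); first by rewrite ler_nat.
have -> : (20 * H ^ 2)%:R = 320 * 1024 ^+ 2 * M%:R ^+ 6 * (K`!)%:R ^+ 4 :> R.
  by rewrite HE rE; ring.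
have leid (x : R) : x <= expR x by apply: le_trans (expR_ge1Dx _); lra.
(* The three summands of the exponent pay for the numerical constant, for M^6 and for (K!)^4 <=
   exp(4 K^2) = exp(1024^2 M^4), with all powers of [M] rounded up to M^7. *)
have -> : (321 * 1024 ^+ 2 + 1) * M%:R ^+ 7 = 320 * 1024 ^+ 2 * M%:R ^+ 7
  + M%:R ^+ 7 + 1024 ^+ 2 * M%:R ^+ 7 :> R by ring.
rewrite !expRD; apply: ler_pM; rewrite ?mulr_ge0 ?exprn_ge0 //.
  apply: ler_pM; rewrite ?mulr_ge0 ?exprn_ge0 //; last exact: le_trans (leid _).
  by apply: le_trans (leid _); rewrite ler_peMr ?mulr_ge0 ?exprn_ge0.
apply: (@le_trans _ _ (expR (K%:R ^+ 2) ^+ 4)).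
  by rewrite lerXn2r ?nnegrE ?expR_ge0 ?fact_le_expR.
rewrite -expRM_natl ler_expR KE natrM natrX exprMn -exprM.
have -> : 4 * (512 ^+ 2 * M%:R ^+ (2 * 2)) = 1024 ^+ 2 * M%:R ^+ 4 :> R by ring.
by rewrite ler_wpM2l ?exprn_ge0.
Qed.

Theorem theorem2 (R : realType) :
  exists (C : R) (M0 : nat), 0 < C /\
    forall M N : nat, (M0 <= M)%N -> expR (C * M%:R ^+ 7) <= N%:R ->
      (D N)%:R / N%:R <= 3 / 4 * ((D M)%:R / M%:R) :> R.
Proof.
exists (321 * 1024 ^+ 2 + 1), 1%N; split=> [|M N M0 leN]; first by lra.
(* The factorial makes [r] divisible by 2h for every 0 < h < K. *)
pose K := (512 * M ^ 2)%N; pose r := (2 * K`!)%N.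
apply: (@D_density_decrement R M N (1024 * M ^ 3 * r ^ 2) K r) => //.
- by rewrite muln_gt0 fact_gt0.
- move=> h /andP[h0 hK]; by rewrite dvdn_pmul2l // dvdn_fact // h0 ltnW.
rewrite -(ler_nat R); apply: le_trans leN.
exact: (@threshold_le_expR R M _ K r).
Qed.
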